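(* Let $F$ be a function of $CZ$ such that $F\ge0$. If there exists $\beta>0$ such that $F^\beta$ is a PEF with power $\beta$ for $\mathcal{C}$, then for all $\nu\in\mathcal{C}$, $$\mathbb{E}_\nu(\log(F(CZ)))\le\mathbb{E}_\nu(-\log(\nu(D|Z))).$$
   Context: $C,Z$ are random variables with finite value spaces and $D$ is a function of $C$. $\mathcal{C}$ is a set of distributions of $CZ$. $\nu(D|Z)$ is the random variable whose value at $cz$ is the conditional probability $\nu(d|z)$, $d=D(c)$. Expectations are sums over values of positive probability only; $\log$ is natural with $\log0=-\infty$. PEF: a probability estimation factor with power $\beta>0$ for $\mathcal{C}$ (and $D|Z$) is a non-negative function $G=G(CZ)$ such that $\mathbb{E}_\nu(G(CZ)\,\nu(D|Z)^\beta)\le1$ for all $\nu\in\mathcal{C}$. *)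

(* Defs.v *)
From mathcomp Require Import all_boot all_order all_algebra.
From mathcomp Require Import all_classical all_reals all_analysis.

Set Implicit Arguments.
Unset Strict Implicit.
Unset Printing Implicit Defensive.

Import Order.TTheory GRing.Theory Num.Theory.
Local Open Scope classical_set_scope.
Local Open Scope ring_scope.

(* Random variables with finite value spaces are identified with their value
   spaces, and the joint distribution of CZ is a probability mass function on
   [C * Z]. *)

Record fdist (R : realType) (T : finType) := FDist {
  pmf :> T -> R ;
  pmf_ge0 : forall x, 0 <= pmf x ;
  pmf_sum1 : \sum_(x : T) pmf x = 1 }.

(* Extended-real valued because the integrand may take the value log 0 = -oo.
   Values of probability 0 do not contribute, whatever the integrand is. *)
Definition expect (R : realType) (T : finType) (nu : fdist R T)
    (f : T -> \bar R) : \bar R :=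
  (\sum_(x : T | (0 < nu x)%R) (nu x)%:E * f x)%E.

Section conditional.
Context {R : realType} {C Z DT : finType}.
Variables (D : C -> DT) (nu : fdist R (C * Z)%type).

Definition probZ (z : Z) : R := \sum_(c : C) nu (c, z).

Definition probDZ (d : DT) (z : Z) : R := \sum_(c : C | D c == d) nu (c, z).

(* If [probZ z = 0] this is 0 by the convention x / 0 = 0; such z are never
   seen by [expect nu]. *)
Definition cprob (d : DT) (z : Z) : R := probDZ d z / probZ z.

(* The random variable nu(D|Z). *)
Definition cprobDZ (cz : C * Z) : R := cprob (D cz.1) cz.2.

End conditional.

Definition is_PEF (R : realType) (C Z DT : finType) (D : C -> DT)
    (M : set (fdist R (C * Z)%type)) (beta : R) (G : C * Z -> R) : Prop :=
  [/\ 0 < beta,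
      forall cz, 0 <= G cz &
      forall nu, M nu ->
        (expect nu (fun cz => (G cz * cprobDZ D nu cz `^ beta)%:E) <= 1)%E].

(* Main.v *)
Require Import Defs.
From mathcomp Require Import all_boot all_order all_algebra.
From mathcomp Require Import all_classical all_reals all_analysis.

(* The PEF inequality says E(x) <= 1 for x = (F nu(D|Z))^beta, and
   ln x <= x - 1 gives E(ln x) <= E(x) - 1 <= 0, where
   ln x = beta (ln F + ln nu(D|Z)). When F vanishes at some value of positive
   probability the left-hand expectation is -oo. *)

Set Implicit Arguments.
Unset Strict Implicit.
Unset Printing Implicit Defensive.

Import Order.TTheory GRing.Theory Num.Theory.
Local Open Scope ring_scope.

Lemma sum_pmf_support (R : realType) (T : finType) (nu : fdist R T) :
  \sum_(x | 0 < nu x) nu x = 1.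
Proof.
rewrite -(Defs.pmf_sum1 nu) [RHS](bigID (fun x => 0 < nu x)) /=.
rewrite [X in _ = _ + X]big1 ?addr0// => x.
by rewrite -leNgt => nux; apply/le_anti; rewrite nux Defs.pmf_ge0.
Qed.

Lemma expect_EFin (R : realType) (T : finType) (nu : fdist R T)
    (f : T -> \bar R) (g : T -> R) :
    (forall x, 0 < nu x -> f x = (g x)%:E) ->
  expect nu f = (\sum_(x | 0 < nu x) nu x * g x)%:E.
Proof.
by move=> fg; rewrite /expect -sumEFin; apply: eq_bigr => x /fg ->.
Qed.

(** In [\bar R], -oo absorbs every other summand, even +oo, and the positive weight [nu x] keeps the
    term at -oo. *)
Lemma expect_eqNy (R : realType) (T : finType) (nu : fdist R T)
    (f : T -> \bar R) (x : T) :
  0 < nu x -> f x = -oo%E -> expect nu f = -oo%E.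
Proof.
move=> nux fx; apply/eqP; rewrite /expect esum_eqNy; apply/existsP.
by exists x; rewrite fx gt0_muleNy ?lte_fin// eqxx andbT.
Qed.

(** Numerator and denominator both contain the positive term [nu (c, z)]. *)
Lemma cprobDZ_gt0 (R : realType) (C Z DT : finType) (D : C -> DT)
    (nu : fdist R (C * Z)%type) (cz : C * Z) :
  0 < nu cz -> 0 < cprobDZ D nu cz.
Proof.
case: cz => c z nu_gt0; rewrite /cprobDZ /cprob /probDZ /probZ/=.
apply: divr_gt0; rewrite (bigD1 c)//= ltr_wpDr// sumr_ge0// => ? _;
  exact: Defs.pmf_ge0.
Qed.

Theorem theorem38 (R : realType) (C Z DT : finType) (D : C -> DT)
    (M : set (fdist R (C * Z)%type)) (F : C * Z -> R)
    (F_ge0 : forall cz, 0 <= F cz)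
    (F_PEF : exists beta : R,
        0 < beta /\ is_PEF D M beta (fun cz => F cz `^ beta)) :
  forall nu : fdist R (C * Z)%type, M nu ->
    (expect nu (fun cz => lne (F cz)%:E)
       <= expect nu (fun cz => - lne (cprobDZ D nu cz)%:E))%E.
Proof.
move=> nu Mnu; have [beta [beta_gt0 [_ _ /(_ nu Mnu) PEF_le1]]] := F_PEF.
have [[cz [nu_gt0 Fcz0]]|F_neq0] :=
    pselect (exists cz, 0 < nu cz /\ F cz = 0).
  by rewrite (expect_eqNy nu_gt0) ?leNye// Fcz0 le0_lneNy.
have F_gt0 cz : 0 < nu cz -> 0 < F cz.
  move=> nu_gt0; rewrite lt_neqAle F_ge0 andbT eq_sym.
  by apply/eqP => Fcz0; apply: F_neq0; exists cz.
(* On the support both logarithms are finite, so the claim becomes one about real sums. *)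
rewrite (expect_EFin (g := fun cz => ln (F cz))); last first.
  by move=> cz /F_gt0 F0; rewrite lne_EFin.
rewrite (expect_EFin (g := fun cz => - ln (cprobDZ D nu cz))); last first.
  by move=> cz /(cprobDZ_gt0 D) q0; rewrite lne_EFin.
rewrite lee_fin -subr_le0 -sumrB -(pmulr_rle0 _ beta_gt0) mulr_sumr.
move: PEF_le1; rewrite (expect_EFin (fun _ _ => erefl)) lee_fin -subr_le0.
(* Writing 1 as the total mass of the support turns E(x) - 1 into a single sum, to be compared term
   by term. *)
apply: le_trans; rewrite -(sum_pmf_support nu) -sumrB.
apply: ler_sum => cz nu_gt0.
have F0 := F_gt0 _ nu_gt0; have q0 := cprobDZ_gt0 D nu_gt0.
(* The logarithms and the factor [beta] merge into ln x; cancelling [nu cz] leaves 1 + ln x <= x. *)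
rewrite -mulrBr opprK -lnM// mulrCA -ln_powR -(powRM _ (ltW F0) (ltW q0)).
rewrite -[X in _ - X]mulr1 -mulrBr ler_pM2l// lerBrDl.
have x0 : 0 < (F cz * cprobDZ D nu cz) `^ beta by rewrite powR_gt0// mulr_gt0.
(* This is 1 + y <= exp y at y = ln x. *)
by rewrite -[leRHS]lnK// expR_ge1Dx.
Qed.
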